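(* Let $p$ be a nonzero complex number that is not a root of unity, and let $(W,Y_W)$ be a $(\mathbb{Z},\chi_p)$-covariant $\phi$-coordinated quasi $V_{\hat E}(1,0)$-module. Then $W$ is a restricted module for $\mathcal{V}ir_{p,-1}$ with $T(x)=Y_W(e^{(1)},x)$.
   Context: All vector spaces are over $\mathbb{C}$; $\delta(x)=\sum_{n\in\mathbb{Z}}x^n$; $U((x))$ is the space of lower truncated Laurent series and $U((x_1,x_2))=U[[x_1,x_2]][x_1^{-1},x_2^{-1}]$. $\mathcal{E}(W)=\mathrm{Hom}(W,W((x)))\subset(\mathrm{End}\,W)[[x,x^{-1}]]$. Deformed Virasoro algebra with $q=-1$: $\mathcal{V}ir_{p,-1}$ is the (topological) unital associative algebra with generators $T_n$ $(n\in\mathbb{Z})$ and, with $T(x)=\sum_{n\in\mathbb{Z}}T_nx^{-n}$, defining relation $$\left(\frac{1+x_2/x_1}{1-x_2/x_1}\right)T(x_1)T(x_2)-\left(\frac{1+x_1/x_2}{1-x_1/x_2}\right)T(x_2)T(x_1)=-2\left(\frac{1+p}{1-p}\right)\left(\delta\left(\frac{px_2}{x_1}\right)-\delta\left(\frac{p^{-1}x_2}{x_1}\right)\right),$$ where $\frac{1+z}{1-z}$ is expanded as $1+2\sum_{l\ge1}z^l$. A module $W$ is restricted if for each $w\in W$, $T_nw=0$ for $n$ sufficiently large, i.e. $T(x)\in\mathcal{E}(W)$. (So a restricted module is a vector space $W$ with operators $T_n$ such that $T(x)\in\mathcal{E}(W)$ and the relation $\left(\frac{1+x_2/x_1}{1-x_2/x_1}\right)T(x_1)T(x_2)-\left(\frac{1+x_1/x_2}{1-x_1/x_2}\right)T(x_2)T(x_1)=-2\left(\frac{1+p}{1-p}\right)\left(\delta\left(\frac{px_2}{x_1}\right)-\delta\left(\frac{p^{-1}x_2}{x_1}\right)\right)$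 holds on $W$.) Vertex superalgebra $V_{\hat E}(1,0)$: $E$ has basis $\{e^{(r)}\mid r\in\mathbb{Z}\}$ with bilinear form $\langle e^{(r)},e^{(s)}\rangle=2(\delta_{r,s+1}+\delta_{r,s-1})$. $\mathrm{Cl}(L(E),1)$ is the unital associative algebra generated by $L(E)=E\otimes\mathbb{C}[t,t^{-1}]$, with $a_n=a\otimes t^n$, subject to $a_mb_n+b_na_m=\langle a,b\rangle\delta_{m+n+1,0}$ for $a,b\in E$, $m,n\in\mathbb{Z}$. Put $a(x)=\sum_{n}a_nx^{-n-1}$. $V_{\hat E}(1,0)=\mathrm{Cl}(L(E),1)/\mathrm{Cl}(L(E),1)(E\otimes\mathbb{C}[t])$, with $\mathbf 1$ the image of $1$ and $E$ identified with a subspace via $a\mapsto a_{-1}\mathbf 1$; it has a unique vertex superalgebra structure with vacuum $\mathbf 1$ and $Y(a,x)=a(x)$ for $a\in E$ (elements of $E$ odd). $\mathbb{Z}$ acts on $V_{\hat E}(1,0)$ by automorphisms $\sigma_m$ determined by $\sigma_m(e^{(r)})=e^{(m+r)}$, and $\chi_p:\mathbb{Z}\to\mathbb{C}^\times$ is the character $\chi_p(n)=p^n$. For a vertex superalgebra $V$ (a particular weak quantum vertex algebra of T-type, where T-type means that for any $u,v\in V$ there exist $u^{(i)},v^{(i)}\in V$, $f_i(x)\in\mathbb{C}(x)$ $(i=1,\dots,r)$ and a nonnegative integer $k$ with $(x_1-x_2)^kY(u,x_1)Y(v,x_2)=(x_1-x_2)^k\sum_{i=1}^r\iota_{x_2,x_1}(f_i(e^{x_1-x_2}))Y(v^{(i)},x_2)Y(u^{(i)},x_1)$,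 $\iota_{x_2,x_1}$ denoting expansion in $\mathbb{C}((x_2))((x_1))$), a $\phi$-coordinated quasi $V$-module (with $\phi(x,z)=xe^z$) is a vector space $W$ with a linear map $Y_W(\cdot,x):V\to\mathrm{Hom}(W,W((x)))$ such that $Y_W(\mathbf 1,x)=1_W$ and for $u,v\in V$ there is a nonzero polynomial $h(x)$ with $h(x_1/x_2)Y_W(u,x_1)Y_W(v,x_2)\in\mathrm{Hom}(W,W((x_1,x_2)))$ and $h(e^z)Y_W(Y(u,z)v,x_2)=\big(h(x_1/x_2)Y_W(u,x_1)Y_W(v,x_2)\big)|_{x_1=x_2e^z}$. If a group $G$ acts on $V$ by automorphisms and $\chi:G\to\mathbb{C}^\times$ is a linear character, such a module is $(G,\chi)$-covariant if $Y_W(gv,x)=Y_W(v,\chi(g)x)$ for $g\in G$, $v\in V$, and for $u,v\in V$ there is a nonzero $h(x)\in\mathbb{C}[x]$ with zeroes only in $\chi(G)$ such that $h(x_1/x_2)Y_W(u,x_1)Y_W(v,x_2)\in\mathrm{Hom}(W,W((x_1,x_2)))$. *)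

(* Defs.v *)
From HB Require Import structures.
From mathcomp Require Import all_boot all_order all_algebra.
From mathcomp Require Import ring_quotient.
From mathcomp Require Import boolp classical_sets fsbigop reals.
From mathcomp Require Import finmap complex monalg.

Set Implicit Arguments.
Unset Strict Implicit.
Unset Printing Implicit Defensive.
Import Order.TTheory GRing.Theory Num.Theory.
Local Open Scope ring_scope.
Local Open Scope quotient_scope.

(* Outside commutative rings, ring_quotient only provides the Z-module structure
   of a quotient; the remaining operations on V / span(gen) and A / (rel) are
   added here. *)
Section ModuleQuotient.
Context (K : pzRingType) (V : lmodType K) (gen : V -> Prop).

Inductive linear_span : V -> Prop :=
| Span0 : linear_span 0
| SpanD x y : linear_span x -> linear_span y -> linear_span (x + y)
| SpanZ c x : gen x -> linear_span (c *: x).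

Lemma linear_spanZ c x : linear_span x -> linear_span (c *: x).
Proof.
elim=> [|u v _ hu _ hv|d u hu]; first by rewrite scaler0; exact: Span0.
  by rewrite scalerDr; exact: SpanD.
by rewrite scalerA; exact: SpanZ.
Qed.

Definition span_pred : {pred V} := fun x => `[< linear_span x >].

Lemma span_zmod_closed : zmod_closed span_pred.
Proof.
split=> [|x y /asboolP hx /asboolP hy]; first exact/asboolP/Span0.
by apply/asboolP/SpanD => //; rewrite -scaleN1r; exact: linear_spanZ.
Qed.

HB.instance Definition _ :=
  GRing.isZmodClosed.Build V span_pred span_zmod_closed.

Definition lmod_quot := {ideal_quot span_pred}.

HB.instance Definition _ := GRing.Zmodule.on lmod_quot.
HB.instance Definition _ := EqQuotient.on lmod_quot.

Definition lmod_pi (x : V) : lmod_quot := \pi x.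

Lemma lmod_pi_eq x y : linear_span (x - y) -> lmod_pi x = lmod_pi y.
Proof. by move=> h; apply/eqP; rewrite -Quotient.idealrBE; apply/asboolP. Qed.

Lemma lmod_pi_repr (q : lmod_quot) : lmod_pi (repr q) = q.
Proof. exact: reprK. Qed.

Lemma lmod_repr_pi x : linear_span (repr (lmod_pi x) - x).
Proof.
by apply/asboolP; rewrite -[asbool _]/(_ \in span_pred) Quotient.idealrBE reprK.
Qed.

Lemma lmod_piD : {morph lmod_pi : x y / x + y}.
Proof. exact: (raddfD (\pi_lmod_quot)). Qed.

Definition lmod_quot_scale (c : K) (q : lmod_quot) : lmod_quot :=
  lmod_pi (c *: repr q).

Lemma lmod_piZ c x : lmod_pi (c *: x) = lmod_quot_scale c (lmod_pi x).
Proof.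
apply/esym/lmod_pi_eq; rewrite -scalerBr.
by apply: linear_spanZ; exact: lmod_repr_pi.
Qed.

Fact lmod_quot_scaleA a b q :
  lmod_quot_scale a (lmod_quot_scale b q) = lmod_quot_scale (a * b) q.
Proof. by rewrite -[q]lmod_pi_repr -!lmod_piZ scalerA. Qed.

Fact lmod_quot_scale1 : left_id 1 lmod_quot_scale.
Proof. by move=> q; rewrite -[q]lmod_pi_repr -lmod_piZ scale1r. Qed.

Fact lmod_quot_scaleDr : right_distributive lmod_quot_scale +%R.
Proof.
move=> c q r; rewrite -[q]lmod_pi_repr -[r]lmod_pi_repr.
by rewrite -lmod_piD -!lmod_piZ scalerDr lmod_piD.
Qed.

Fact lmod_quot_scaleDl q : {morph lmod_quot_scale^~ q : a b / a + b}.
Proof.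
by move=> a b; rewrite -[q]lmod_pi_repr -!lmod_piZ scalerDl lmod_piD.
Qed.

HB.instance Definition _ := GRing.Zmodule_isLmodule.Build K lmod_quot
  lmod_quot_scaleA lmod_quot_scale1 lmod_quot_scaleDr lmod_quot_scaleDl.

End ModuleQuotient.

Section PresentedAlgebra.
Context (K : comNzRingType) (A : lalgType K) (rel : A -> Prop).

Inductive two_sided_ideal : A -> Prop :=
| Ideal0 : two_sided_ideal 0
| IdealRel r : rel r -> two_sided_ideal r
| IdealD x y : two_sided_ideal x -> two_sided_ideal y ->
    two_sided_ideal (x + y)
| IdealMl a x : two_sided_ideal x -> two_sided_ideal (a * x)
| IdealMr a x : two_sided_ideal x -> two_sided_ideal (x * a).

Definition ideal_pred : {pred A} := fun x => `[< two_sided_ideal x >].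

Lemma ideal_zmod_closed : zmod_closed ideal_pred.
Proof.
split=> [|x y /asboolP hx /asboolP hy]; first exact/asboolP/Ideal0.
by apply/asboolP/IdealD => //; rewrite -mulN1r; apply: IdealMl.
Qed.

HB.instance Definition _ :=
  GRing.isZmodClosed.Build A ideal_pred ideal_zmod_closed.

Definition presented := {ideal_quot ideal_pred}.

HB.instance Definition _ := GRing.Zmodule.on presented.
HB.instance Definition _ := EqQuotient.on presented.

Definition presented_pi (x : A) : presented := \pi x.

Lemma presented_pi_eq x y :
  two_sided_ideal (x - y) -> presented_pi x = presented_pi y.
Proof. by move=> h; apply/eqP; rewrite -Quotient.idealrBE; apply/asboolP. Qed.

Lemma presented_pi_repr (q : presented) : presented_pi (repr q) = q.
Proof. exact: reprK. Qed.

Lemma presented_repr_pi x : two_sided_ideal (repr (presented_pi x) - x).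
Proof.
by apply/asboolP; rewrite -[asbool _]/(_ \in ideal_pred) Quotient.idealrBE
  reprK.
Qed.

Lemma presented_piB : {morph presented_pi : x y / x - y}.
Proof. exact: (raddfB (\pi_presented)). Qed.

Lemma presented_piD : {morph presented_pi : x y / x + y}.
Proof. exact: (raddfD (\pi_presented)). Qed.

Definition presented_mul (q r : presented) : presented :=
  presented_pi (repr q * repr r).
Definition presented_scale (c : K) (q : presented) : presented :=
  presented_pi (c *: repr q).

Lemma presented_piM x y :
  presented_pi (x * y) = presented_mul (presented_pi x) (presented_pi y).
Proof.
apply/esym/presented_pi_eq.
rewrite -[repr _ * _](subrK (x * repr (presented_pi y))) -mulrBl -addrA -mulrBr.
by apply: IdealD; [apply: IdealMr | apply: IdealMl]; exact: presented_repr_pi.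
Qed.

Lemma presented_piZ c x :
  presented_pi (c *: x) = presented_scale c (presented_pi x).
Proof.
apply/esym/presented_pi_eq; rewrite -scalerBr -[_ - x]mul1r scalerAl.
by apply: IdealMl; exact: presented_repr_pi.
Qed.

Fact presented_mulA : associative presented_mul.
Proof.
move=> q r s; rewrite -[q]presented_pi_repr -[r]presented_pi_repr.
by rewrite -[s]presented_pi_repr -!presented_piM mulrA.
Qed.

Fact presented_mul1l : left_id (presented_pi 1) presented_mul.
Proof. by move=> q; rewrite -[q]presented_pi_repr -presented_piM mul1r. Qed.

Fact presented_mul1r : right_id (presented_pi 1) presented_mul.
Proof. by move=> q; rewrite -[q]presented_pi_repr -presented_piM mulr1. Qed.

Fact presented_mulDl : left_distributive presented_mul +%R.
Proof.
move=> q r s; rewrite -[q]presented_pi_repr -[r]presented_pi_repr.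
rewrite -[s]presented_pi_repr.
by rewrite -presented_piD -!presented_piM mulrDl presented_piD.
Qed.

Fact presented_mulDr : right_distributive presented_mul +%R.
Proof.
move=> q r s; rewrite -[q]presented_pi_repr -[r]presented_pi_repr.
rewrite -[s]presented_pi_repr.
by rewrite -presented_piD -!presented_piM mulrDr presented_piD.
Qed.

HB.instance Definition _ := GRing.Zmodule_isPzRing.Build presented
  presented_mulA presented_mul1l presented_mul1r presented_mulDl
  presented_mulDr.

Fact presented_scaleA a b q :
  presented_scale a (presented_scale b q) = presented_scale (a * b) q.
Proof. by rewrite -[q]presented_pi_repr -!presented_piZ scalerA. Qed.

Fact presented_scale1 : left_id 1 presented_scale.
Proof. by move=> q; rewrite -[q]presented_pi_repr -presented_piZ scale1r. Qed.

Fact presented_scaleDr : right_distributive presented_scale +%R.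
Proof.
move=> c q r; rewrite -[q]presented_pi_repr -[r]presented_pi_repr.
by rewrite -presented_piD -!presented_piZ scalerDr presented_piD.
Qed.

Fact presented_scaleDl q : {morph presented_scale^~ q : a b / a + b}.
Proof.
move=> a b; rewrite -[q]presented_pi_repr -!presented_piZ scalerDl.
exact: presented_piD.
Qed.

HB.instance Definition _ := GRing.Zmodule_isLmodule.Build K presented
  presented_scaleA presented_scale1 presented_scaleDr presented_scaleDl.

Fact presented_scaleAl (c : K) (q r : presented) :
  c *: (q * r) = (c *: q) * r.
Proof.
rewrite -[q]presented_pi_repr -[r]presented_pi_repr.
rewrite -[LHS]/(presented_scale c (presented_mul _ _)).
rewrite -[RHS]/(presented_mul (presented_scale c _) _).
by rewrite -presented_piM -!presented_piZ -presented_piM scalerAl.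
Qed.

End PresentedAlgebra.

(* A formal series in U[[x, x^-1]] is represented by the function int -> U that
   sends n to the coefficient of x^n; in two variables F m n is the coefficient
   of x1^m x2^n. A field A(x) on W is a function A : W -> int -> W.
   The base field is meant to have characteristic 0, because of the factorials. *)
Section FormalSeries.
Context (K : fieldType) (U : lmodType K).
Implicit Types (f : int -> U) (F : int -> int -> U) (A B : U -> int -> U).

(* U((x)) *)
Definition laurent f := exists N : int, forall n, n < N -> f n = 0.

(* U((x1, x2)) = U[[x1, x2]][x1^-1, x2^-1] *)
Definition laurent2 F :=
  exists N : int, forall m n, (m < N) || (n < N) -> F m n = 0.

(* Hom(U, U((x))) *)
Definition is_field A :=
  (forall n, linear (fun w => A w n)) /\ (forall w, laurent (A w)).

(* The coefficient of z^i in h(e^z). *)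
Definition exp_coef (h : {poly K}) (i : nat) : K :=
  \sum_(l < size h) h`_l * (l%:R ^+ i / i`!%:R).

(* The coefficient of z^j in g(z) f(z), for g in K[[z]] and f in U((z)): the
   sum is finite. *)
Definition mul_series (g : nat -> K) f (j : int) : U :=
  \sum_(i \in [set: nat]) g i *: f (j - i%:Z).

(* The coefficient of z^j x2^k in F(x2 e^z, x2), for F in U((x1, x2)): the sum
   is finite. *)
Definition subst_exp F (j k : int) : U :=
  if j is Posz j' then
    \sum_(m \in [set: int]) (m%:~R ^+ j' / j'`!%:R) *: F m (k - m)
  else 0.

(* The coefficient of x1^m x2^n in h(x1/x2) A(x1) B(x2) w. *)
Definition poly_ratio_mul (h : {poly K}) A B (w : U) (m n : int) : U :=
  \sum_(i < size h) h`_i *: A (B w (n + i%:Z)) (m - i%:Z).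

(* The coefficient of x1^m x2^n in (1 + x2/x1)/(1 - x2/x1) A(x1) B(x2) w,
   with (1 + z)/(1 - z) = 1 + 2 z + 2 z^2 + ...: the sum is finite for fields. *)
Definition cayley_ratio_mul A B (w : U) (m n : int) : U :=
  \sum_(l \in [set: nat])
    (if l == 0 then 1 else 2 : K) *: A (B w (n - l%:Z)) (m + l%:Z).

End FormalSeries.

(* The coefficient of x1^m x2^n in delta(c x2/x1). *)
Definition delta_ratio (K : fieldType) (c : K) (m n : int) : K :=
  if m + n == 0 then c ^ n else 0.

(* m (m - 1) ... (m - i + 1) / i! *)
Definition gbinom (K : fieldType) (m : int) (i : nat) : K :=
  (\prod_(j < i) (m - j%:Z)%:~R) / i`!%:R.

Section VertexSuperalgebras.
Context (K : fieldType) (V : lmodType K).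
Implicit Types (par : bool -> V -> Prop) (Y : V -> V -> int -> V).

(* Y u v is the series Y(u, x)v, and u_n is the coefficient of x^(-n-1). *)
Definition vmode Y (u : V) (n : int) (v : V) : V := Y u v (- n - 1).

(* par false and par true are the even and the odd subspace. *)
Record vertex_superalgebra par (vac : V) Y : Prop := VertexSuperalgebra {
  vsa_par0 : forall b, par b 0;
  vsa_par_linear : forall b c u v, par b u -> par b v -> par b (c *: u + v);
  vsa_par_sum : forall v, exists v0 v1, [/\ par false v0, par true v1 & v = v0 + v1];
  vsa_par_direct : forall v, par false v -> par true v -> v = 0;
  vsa_field : forall u, is_field (Y u);
  vsa_linear : forall v n, linear (fun u => Y u v n);
  vsa_mode_par : forall b b' u v n,
    par b u -> par b' v -> par (b (+) b') (vmode Y u n v);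
  vsa_vac_even : par false vac;
  vsa_vacuum : forall v n, Y vac v n = if n == 0 then v else 0;
  vsa_creation : forall v n, n <= 0 -> Y v vac n = if n == 0 then v else 0;
  (* The coefficient of x0^(-l-1) x1^(-m-1) x2^(-n-1) in the Jacobi identity
       x0^-1 delta((x1-x2)/x0) Y(u,x1)Y(v,x2)
         - (-1)^(|u||v|) x0^-1 delta((x2-x1)/(-x0)) Y(v,x2)Y(u,x1)
       = x2^-1 delta((x1-x0)/x2) Y(Y(u,x0)v,x2). *)
  vsa_jacobi : forall b b' u v w l m n, par b u -> par b' v ->
    \sum_(i \in [set: nat]) ((-1) ^+ i * gbinom K l i) *:
      (vmode Y u (m + l - i%:Z) (vmode Y v (n + i%:Z) w)
       - ((-1) ^+ (b && b') * (-1) ^ l) *: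
           vmode Y v (n + l - i%:Z) (vmode Y u (m + i%:Z) w))
    = \sum_(i \in [set: nat]) gbinom K m i *:
        vmode Y (vmode Y u (l + i%:Z) v) (m + n - i%:Z) w
}.

Record vsa_automorphism par (vac : V) Y (s : V -> V) : Prop := VsaAutomorphism {
  vsa_aut_linear : linear s;
  vsa_aut_bij : bijective s;
  vsa_aut_par : forall b v, par b v -> par b (s v);
  vsa_aut_vac : s vac = vac;
  vsa_aut_Y : forall u v n, s (Y u v n) = Y (s u) (s v) n
}.

Section Modules.
Context (W : lmodType K) (vac : V) (Y : V -> V -> int -> V).
(* YW v w is the series Y_W(v, x)w. *)
Context (YW : V -> W -> int -> W).

(* The case phi(x, z) = x e^z. *)
Record phi_coordinated_quasi_module : Prop := PhiCoordinatedQuasiModule {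
  pcq_linear : forall w n, linear (fun v => YW v w n);
  pcq_field : forall v, is_field (YW v);
  pcq_vacuum : forall w n, YW vac w n = if n == 0 then w else 0;
  pcq_assoc : forall u v, exists h : {poly K},
    [/\ h != 0,
        forall w, laurent2 (poly_ratio_mul h (YW u) (YW v) w)
      & forall w j k,
          mul_series (exp_coef h) (fun i => YW (Y u v i) w k) j
          = subst_exp (poly_ratio_mul h (YW u) (YW v) w) j k]
}.

Record covariant_phi_coordinated_quasi_module
    (G : Type) (act : G -> V -> V) (chi : G -> K) : Prop :=
  CovariantPhiCoordinatedQuasiModule {
  cov_module : phi_coordinated_quasi_module;
  cov_equivariant : forall g v w n, YW (act g v) w n = chi g ^ n *: YW v w n;
  cov_locality : forall u v, exists h : {poly K},
    [/\ h != 0,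
        forall z, root h z -> exists g, z = chi g
      & forall w, laurent2 (poly_ratio_mul h (YW u) (YW v) w)]
}.

End Modules.
End VertexSuperalgebras.

Section CliffordVertexSuperalgebra.
Context (K : fieldType).

(* E has basis e^(r), r : int. *)
Definition Espace := {malg K[int]}.
Definition ebasis (r : int) : Espace := << r >>.

Definition eform (a b : Espace) : K :=
  \sum_(r <- msupp a) \sum_(s <- msupp b)
    a@_r * b@_s * (2 * ((r == s + 1)%:R + (r == s - 1)%:R)).

(* The tensor algebra of L(E): the free algebra on the basis e^(r) (x) t^n of
   L(E), indexed by the pairs (r, n). *)
Definition TLE := {malg K[{fmonom (int * int)%type}]}.

(* a_n = a (x) t^n *)
Definition tmode (a : Espace) (n : int) : TLE :=
  \sum_(r <- msupp a) a@_r *: << fmu (r, n) >>.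

Inductive clifford_rel : TLE -> Prop :=
| CliffordRel (a b : Espace) (m n : int) :
    clifford_rel (tmode a m * tmode b n + tmode b n * tmode a m
                  - (eform a b * (m + n + 1 == 0)%:R) *: 1).

Definition clifford := presented clifford_rel.
HB.instance Definition _ := GRing.PzRing.on clifford.
HB.instance Definition _ := GRing.Lmodule.on clifford.

Definition clmode (a : Espace) (n : int) : clifford :=
  presented_pi clifford_rel (tmode a n).

(* The left ideal Cl(L(E),1)(E (x) C[t]) is the span of these products. *)
Inductive annihilation_product : clifford -> Prop :=
| AnnihilationProduct (c : clifford) (a : Espace) (n : nat) :
    annihilation_product (c * clmode a n%:Z).

(* The vector space underlying V_E(1,0). *)
Definition VE := lmod_quot annihilation_product.
HB.instance Definition _ := GRing.Lmodule.on VE.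

Definition VE_pi (c : clifford) : VE := lmod_pi annihilation_product c.
Definition VE_vac : VE := VE_pi 1.
Definition VE_of (a : Espace) : VE := VE_pi (clmode a (-1)).


(* The vertex superalgebra structure on V_E(1,0): Y(a, x) = a(x) for a in E,
   where a_n acts on Cl / Cl(E (x) C[t]) by left multiplication. *)
Record VE_structure (par : bool -> VE -> Prop) (Y : VE -> VE -> int -> VE)
    : Prop := VEStructure {
  VE_vsa : vertex_superalgebra par VE_vac Y;
  VE_odd : forall a, par true (VE_of a);
  VE_Y : forall a n c, vmode Y (VE_of a) n (VE_pi c) = VE_pi (clmode a n * c)
}.

(* The action of the group int on V_E(1,0). *)
Record VE_action (par : bool -> VE -> Prop) (Y : VE -> VE -> int -> VE)
    (sigma : int -> VE -> VE) : Prop := VEAction {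
  VE_act_aut : forall m, vsa_automorphism par VE_vac Y (sigma m);
  VE_act0 : forall v, sigma 0 v = v;
  VE_actD : forall m n v, sigma (m + n) v = sigma m (sigma n v);
  VE_act_basis : forall m r,
    sigma m (VE_of (ebasis r)) = VE_of (ebasis (m + r))
}.

End CliffordVertexSuperalgebra.

(* T n w = T_n w, where T(x) is the sum of the T_n x^-n; the relation of
   Vir_{p,-1} is stated for the coefficients of x1^m x2^n. *)
Record restricted_Vir_module (K : fieldType) (p : K) (W : lmodType K)
    (T : int -> W -> W) (Tx := fun w n => T (- n) w) : Prop :=
  RestrictedVirModule {
  Vir_linear : forall n, linear (T n);
  Vir_restricted : forall w, exists N : int, forall n, N < n -> T n w = 0;
  Vir_relation : forall w m n,
    cayley_ratio_mul Tx Tx w m n - cayley_ratio_mul Tx Tx w n m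
    = (- 2 * ((1 + p) / (1 - p))
       * (delta_ratio p m n - delta_ratio p^-1 m n)) *: w
}.

(* Main.v *)
Require Import Defs.
From mathcomp Require Import all_boot all_order all_algebra.
From mathcomp Require Import boolp classical_sets fsbigop reals.
From mathcomp Require Import finmap complex monalg.
From mathcomp Require Import zify ring.

(* On the line m + n = k the coefficients f m of T(x1)T(x2)w form one series in
   x = x1/x2, bounded above, and those of T(x2)T(x1)w are the f (k - m),
   bounded below. By locality f is the expansion at infinity of a W-valued
   rational function R with poles in the powers of p only. Covariance and
   associativity identify the expansion of R(p^r e^z) in z with the coefficient
   of x2^k in Y_W(Y(e^(1+r),z)e^(1),x2)w, whose only polar term is
   <e^(1+r),e^(1)> z^-1 w (for k = 0): so R has at most simple poles, at p and
   1/p. The anticommutators in the Clifford algebra and covariance give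
   R(p^r) = - p^(rk) R(p^-r) for all r, hence R(x) = - x^k R(1/x), as p^r takes
   infinitely many values. Therefore R(1) = 0, the f (k - m) are the
   coefficients of the expansion of - R at 0, and the left side of the relation
   is the difference of the expansions of (x + 1)/(x - 1) R(x) at infinity and
   at 0, that is, the sum of the delta functions at the two poles. *)

Set Implicit Arguments.
Unset Strict Implicit.
Unset Printing Implicit Defensive.
Import Order.TTheory GRing.Theory Num.Theory.
Local Open Scope ring_scope.

(** * Two-sided series with coefficients in W and finite sums over the exponents *)

Section FiniteSums.
Context (K : fieldType) (W : lmodType K).
Implicit Types (f g : int -> W) (h p q : {poly K}).

Definition bounded_above f := exists N : int, forall m, N < m -> f m = 0.
Definition fin_series f := laurent f /\ bounded_above f.
Definition vanishes_off f (N : int) (n : nat) :=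
  forall i, (i < N) || (N + n%:Z <= i) -> f i = 0.

Lemma fin_seriesP f : fin_series f <-> exists N n, vanishes_off f N n.
Proof.
split=> [[[N fN] [M fM]]|[N [n fE]]].
  exists N, (absz (M + 1 - N)%R) => i /orP[/fN//|hi]; apply: fM; lia.
by split; [exists N|exists (N + n%:Z)] => i hi; apply: fE; lia.
Qed.

Lemma fsumE f N n : vanishes_off f N n ->
  \sum_(m \in [set: int]) f m = \sum_(i < n) f (N + i%:Z).
Proof.
move=> fE.
rewrite (fsbigTE [fset m in [seq (N + i%:Z)%R | i <- iota 0 n]]%fset); last first.
  move=> m; rewrite inE /= => /mapP hm; apply: fE.
  case: ltP => //= h1; rewrite leNgt; apply/negP => h2; apply: hm.
  exists (absz (m - N)%R); last by lia.
  by rewrite mem_iota; lia.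
rewrite -(big_mkord xpredT (fun i => f (N + i%:Z))) /index_iota subn0.
rewrite -(big_map (fun i : nat => N + i%:Z) xpredT f).
apply: perm_big; apply: uniq_perm; first exact: fset_uniq.
  by rewrite map_inj_uniq ?iota_uniq // => i j; lia.
by move=> m; rewrite !inE.
Qed.

Lemma fin_series_common_window f g : fin_series f -> fin_series g ->
  exists N n, vanishes_off f N n /\ vanishes_off g N n.
Proof.
move=> /fin_seriesP[N [n fE]] /fin_seriesP[N' [n' gE]].
exists (Order.min N N').
exists (absz (Order.max (N + n%:Z) (N' + n'%:Z) - Order.min N N')%R).
by split=> i hi; [apply: fE|apply: gE]; lia.
Qed.

Lemma fsumD f g : fin_series f -> fin_series g ->
  \sum_(m \in [set: int]) (f m + g m) =
  \sum_(m \in [set: int]) f m + \sum_(m \in [set: int]) g m.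
Proof.
move=> /fin_series_common_window /[apply] -[N [n [fE gE]]].
rewrite (fsumE fE) (fsumE gE) (@fsumE _ N n) ?big_split // => i hi.
by rewrite fE // gE // addr0.
Qed.

Lemma fsumZ c f : fin_series f ->
  \sum_(m \in [set: int]) (c *: f m) = c *: \sum_(m \in [set: int]) f m.
Proof.
move=> /fin_seriesP[N [n fE]].
rewrite (fsumE fE) (@fsumE _ N n) ?scaler_sumr // => i hi.
by rewrite fE // scaler0.
Qed.

Lemma fsum_shift f (a : int) :
  \sum_(m \in [set: int]) f (m + a) = \sum_(m \in [set: int]) f m.
Proof.
rewrite [RHS](reindex_fsbigT (fun m => m + a)) //.
by exists (fun m => m - a) => x; rewrite ?addrK ?subrK.
Qed.

Lemma fsum_rev f (a : int) :
  \sum_(m \in [set: int]) f (a - m) = \sum_(m \in [set: int]) f m.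
Proof.
rewrite [RHS](reindex_fsbigT (fun m => a - m)) //.
by exists (fun m => a - m) => x; lia.
Qed.

Lemma fin_seriesZ (phi : int -> K) f :
  fin_series f -> fin_series (fun m => phi m *: f m).
Proof.
by move=> /fin_seriesP[N [n fE]]; apply/fin_seriesP; exists N, n => i /fE ->;
  rewrite scaler0.
Qed.

Lemma fin_seriesD f g :
  fin_series f -> fin_series g -> fin_series (fun m => f m + g m).
Proof.
move=> /fin_series_common_window /[apply] -[N [n [fE gE]]]; apply/fin_seriesP.
by exists N, n => i hi; rewrite fE // gE // addr0.
Qed.

Lemma fin_series_shift f a : fin_series f -> fin_series (fun m => f (m + a)).
Proof.
move=> [[N fN] [M fM]]; split; [exists (N - a)|exists (M - a)] => m hm.
  by apply: fN; lia.
by apply: fM; lia.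
Qed.

Lemma fin_series_rev f a : fin_series f -> fin_series (fun m => f (a - m)).
Proof.
move=> [[N fN] [M fM]]; split; [exists (a - M)|exists (a - N)] => m hm.
  by apply: fM; lia.
by apply: fN; lia.
Qed.

Lemma fsum_sum n (F : nat -> int -> W) : (forall i, fin_series (F i)) ->
  \sum_(m \in [set: int]) \sum_(i < n) F i m =
    \sum_(i < n) \sum_(m \in [set: int]) F i m
  /\ fin_series (fun m => \sum_(i < n) F i m).
Proof.
move=> Ffin; elim: n => [|n [IHe IHf]].
  split; first by rewrite fsbig1 ?big_ord0 // => i _; rewrite big_ord0.
  by split; exists 0 => m _; rewrite big_ord0.
split.
  rewrite big_ord_recr /= -IHe -fsumD //.
  by apply: eq_fsbigr => m _; rewrite big_ord_recr.
have := fin_seriesD IHf (Ffin n).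
by congr fin_series; apply/funext => m /=; rewrite big_ord_recr.
Qed.

(** * Multiplication of a two-sided series by a polynomial *)

Definition conv h f (m : int) : W := \sum_(i < size h) h`_i *: f (m - i%:Z).

Lemma convE n h f m : (size h <= n)%N ->
  conv h f m = \sum_(i < n) h`_i *: f (m - i%:Z).
Proof.
move=> hn; rewrite /conv (big_ord_widen n (fun i => h`_i *: f (m - i%:Z))) //.
rewrite big_mkcond; apply: eq_bigr => i _; case: ltnP => // hi.
by rewrite nth_default // scale0r.
Qed.

Lemma convD p q f : conv (p + q) f = fun m => conv p f m + conv q f m.
Proof.
apply/funext => m /=; pose n := maxn (size p) (size q).
rewrite !(@convE n) ?leq_maxl ?leq_maxr ?size_polyD // -big_split.
by apply: eq_bigr => i _; rewrite coefD scalerDl.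
Qed.

Lemma convZ c p f : conv (c *: p) f = fun m => c *: conv p f m.
Proof.
apply/funext => m /=; rewrite (@convE (size p)) ?size_scale_leq // scaler_sumr.
by apply: eq_bigr => i _; rewrite coefZ scalerA.
Qed.

Lemma conv_polyC c f m : conv c%:P f m = c *: f m.
Proof. by rewrite (@convE 1) ?size_polyC_leq1 // big_ord1 coefC eqxx subr0. Qed.

Lemma conv_mulX p f m : conv (p * 'X) f m = conv p f (m - 1).
Proof.
rewrite (@convE (size p).+1); last first.
  by rewrite (leq_trans (size_polyMleq _ _)) // size_polyX addn2.
rewrite big_ord_recl coefMX eqxx scale0r add0r.
apply: eq_bigr => i _; rewrite coefMX /=.
by congr (_ *: f _); rewrite /bump /=; lia.
Qed.

Lemma conv0 f : conv 0 f = fun=> 0.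
Proof. by apply/funext => m /=; rewrite /conv size_poly0 big_ord0. Qed.

(** Two-sided series thus form a module over K[x]. It has torsion, such as delta functions, so
    cancelling a factor takes a bound on the support. *)
Lemma convM p q f : conv (p * q) f = conv p (conv q f).
Proof.
apply/funext => m /=; elim/poly_ind: p m => [|p c IHp] m; first by rewrite mul0r !conv0.
rewrite mulrDl -mulrA -(commr_polyX q) mulrA mul_polyC !convD convZ.
by rewrite !conv_mulX conv_polyC IHp.
Qed.

Lemma convDr p f g :
  conv p (fun m => f m + g m) = fun m => conv p f m + conv p g m.
Proof.
apply/funext => m /=; rewrite -big_split.
by apply: eq_bigr => i _; rewrite scalerDr.
Qed.

Lemma convZr p c f : conv p (fun m => c *: f m) = fun m => c *: conv p f m.
Proof.
apply/funext => m /=; rewrite scaler_sumr.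
by apply: eq_bigr => i _; rewrite !scalerA mulrC.
Qed.

Lemma conv_laurent p f : laurent f -> laurent (conv p f).
Proof.
move=> [N fN]; exists N => m hm; rewrite /conv big1 // => i _.
by rewrite fN ?scaler0 //; lia.
Qed.

Lemma conv_bounded_above p f : bounded_above f -> bounded_above (conv p f).
Proof.
move=> [N fN]; exists (N + (size p)%:Z) => m hm; rewrite /conv big1 // => i _.
have hi := ltn_ord i; rewrite fN ?scaler0 //.
by move: hm hi; lia.
Qed.

Lemma conv_fin_series p f : fin_series f -> fin_series (conv p f).
Proof. by move=> [hl hb]; split; [exact: conv_laurent|exact: conv_bounded_above]. Qed.

Lemma conv_XsubC c f m : conv ('X - c%:P) f m = f (m - 1) - c *: f m.
Proof.
rewrite -polyCN convD conv_polyC scaleNr; congr (_ - _).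
by rewrite -['X]mul1r conv_mulX conv_polyC scale1r.
Qed.

(* The substitutions of [x1 = c x2] and [x1 = x2 e^z] are both sums weighted
   by a scalar function of the exponent. *)
Definition pairing (phi : int -> K) f := \sum_(m \in [set: int]) phi m *: f m.

Lemma pairing_conv phi h f : fin_series f ->
  pairing phi (conv h f) = \sum_(l < size h) h`_l *: pairing (fun m => phi (m + l%:Z)) f.
Proof.
move=> ffin; rewrite /pairing.
have Hfin (l : nat) : fin_series (fun m => phi m *: (h`_l *: f (m - l%:Z))).
  by apply: fin_seriesZ; apply: (@fin_seriesZ (fun=> h`_l)); exact: fin_series_shift.
transitivity (\sum_(m \in [set: int])
  \sum_(l < size h) phi m *: (h`_l *: f (m - l%:Z))).
  by apply: eq_fsbigr => m _; rewrite scaler_sumr.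
rewrite (fsum_sum _ Hfin).1; apply: eq_bigr => l _.
rewrite -fsumZ; last exact: fin_seriesZ.
rewrite -[LHS](fsum_shift _ l%:Z); apply: eq_fsbigr => m _.
by rewrite addrK !scalerA mulrC.
Qed.

Lemma pairingD phi f g : fin_series f -> fin_series g ->
  pairing phi (fun m => f m + g m) = pairing phi f + pairing phi g.
Proof.
move=> hf hg; rewrite -fsumD; [|exact: fin_seriesZ..].
by apply: eq_fsbigr => m _; rewrite scalerDr.
Qed.

(** * Evaluation at a point, residues, and division by a linear factor *)

Definition ev (c : K) := pairing (fun m => c ^ m).

Lemma ev_conv c h f : c != 0 -> fin_series f -> ev c (conv h f) = h.[c] *: ev c f.
Proof.
move=> c0 hf; rewrite /ev pairing_conv // horner_coef scaler_suml.
apply: eq_bigr => l _; rewrite -scalerA; congr (_ *: _).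
rewrite -fsumZ; last exact: fin_seriesZ.
by apply: eq_fsbigr => m _; rewrite scalerA expfzDr // mulrC.
Qed.

(** Expansions f at infinity and g at 0 of b(x)/(x - c) differ by the delta series with coefficients
    b(c) c^(-m-1). Asking for each recurrence on one side of M only allows g = 0 in
    [divide_root]. *)
Lemma residue c f g b (M : int) : c != 0 -> bounded_above f -> laurent g ->
    (forall m, M < m -> f (m - 1) - c *: f m = b m) ->
    (forall m, m <= M -> g (m - 1) - c *: g m = b m) ->
  c ^ (M + 1) *: (f M - g M) = ev c b.
Proof.
move=> c0 [N fN] [N' gN] fb gb; pose u m := if M < m then f m else g m.
(* The finite series [u] satisfies [(x - c) u = b] up to one term, at [M + 1],
   and [(x - c) u] vanishes at [x = c]. *)
have ufin : fin_series u.
  split; [exists (Order.min N' M)|exists (Order.max N M)] => m hm; rewrite /u.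
    by rewrite ifF ?gN //; lia.
  by rewrite ifT ?fN //; lia.
pose d m := if m == M + 1 then f M - g M else 0.
have dfin : fin_series d.
  by split; exists (M + 1) => m hm; rewrite /d ifF //; lia.
have -> : b = fun m => conv ('X - c%:P) u m + d m.
  apply/funext => m /=; rewrite conv_XsubC /u /d.
  have [ltm|gtm|->] := ltgtP m (M + 1).
  - by rewrite !ifF ?addr0 ?gb //; lia.
  - by rewrite !ifT ?addr0 ?fb //; lia.
  - rewrite addrK ltxx ifT; last by lia.
    rewrite -fb ?addrK; last by lia.
    by rewrite [RHS]addrC addrA subrK.
rewrite /ev pairingD //; last exact: conv_fin_series.
rewrite -/(ev c _) ev_conv // hornerXsubC subrr scale0r add0r.
rewrite /pairing (@fsumE _ (M + 1) 1) ?big_ord1 ?addr0 /d ?eqxx // => m hm.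
by rewrite ifF ?scaler0 //; lia.
Qed.

(** Below the support of the product the zero series solves the same recurrence, so by [residue]
    each coefficient there is, up to a power of c, the value at c, which is 0. *)
Lemma divide_root c h f : c != 0 -> bounded_above f ->
    fin_series (conv (('X - c%:P) * h) f) -> ev c (conv (('X - c%:P) * h) f) = 0 ->
  fin_series (conv h f).
Proof.
move=> c0 hf; rewrite convM => -[[N bN] _] b0.
split; last exact: conv_bounded_above.
exists (N - 1) => M hM; have := @residue c (conv h f) (fun=> 0) _ M c0
  (conv_bounded_above _ hf) _ _ _.
move/(_ (conv ('X - c%:P) (conv h f))); rewrite b0 subr0 => H.
have /eqP : c ^ (M + 1) *: conv h f M = 0.
  apply: H => [|m _|m hm]; first by exists 0.
    by rewrite conv_XsubC.
  by rewrite bN ?scaler0 ?subr0 //; lia.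
by rewrite scaler_eq0 expfz_eq0 (negPf c0) andbF => /eqP.
Qed.

End FiniteSums.

(** * Vandermonde systems with unknowns in W *)

Lemma Vandermonde_unit (K : fieldType) n (x : 'I_n -> K) : injective x ->
  Vandermonde n (\row_j x j) \in unitmx.
Proof.
move=> xinj; rewrite unitmxE det_Vandermonde unitfE.
apply/prodf_neq0 => i _; apply/prodf_neq0 => j ij.
by rewrite !mxE subr_eq0 (inj_eq xinj) eq_sym -val_eqE neq_ltn ij.
Qed.

Lemma power_sums_eq0 (K : fieldType) (W : lmodType K) n (x : 'I_n -> K)
    (y : 'I_n -> W) : injective x ->
  (forall j, \sum_(i < n) x j ^+ i *: y i = 0) -> forall i, y i = 0.
Proof.
move=> /Vandermonde_unit; set V := Vandermonde _ _ => Vu yx i0.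
(* Column [i0] of the inverse matrix combines the equations into one that isolates [y i0]. *)
transitivity (\sum_(j < n) invmx V j i0 *: \sum_(i < n) x j ^+ i *: y i); last first.
  by rewrite big1 // => j _; rewrite yx scaler0.
under eq_bigr => j _ do rewrite scaler_sumr.
rewrite exchange_big /=.
transitivity (\sum_(i < n) (i == i0)%:R *: y i).
  rewrite (bigD1 i0) //= eqxx scale1r big1 ?addr0 // => i /negPf ->.
  by rewrite scale0r.
apply: eq_bigr => i _.
have := congr1 (fun M : 'M_n => M i i0) (mulmxV Vu); rewrite !mxE => <-.
by rewrite scaler_suml; apply: eq_bigr => j _; rewrite scalerA !mxE mulrC.
Qed.

(** Without the factor c^N, f is a polynomial with n coefficients in W, and its values at n distinct
    points determine them. *)
Lemma ev_inj0 (K : fieldType) (W : lmodType K) (c : nat -> K) (f : int -> W) :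
    injective c -> (forall j, c j != 0) -> fin_series f ->
  (forall j, ev (c j) f = 0) -> forall m, f m = 0.
Proof.
move=> cinj c0 /fin_seriesP[N [n fE]] evf.
have f0 : forall i : 'I_n, f (N + i%:Z) = 0.
  apply: (@power_sums_eq0 _ _ n (fun j => c j)).
    by move=> i j /cinj /val_inj.
  move=> j; have := evf j; rewrite /ev /pairing (@fsumE _ _ _ N n); last first.
    by move=> i hi; rewrite fE ?scaler0.
  under eq_bigr => i _ do rewrite expfzDr // -scalerA.
  rewrite -scaler_sumr => /eqP; rewrite scaler_eq0 expfz_eq0 (negPf (c0 j)) andbF.
  by move/eqP.
move=> m; have [hm|hm] := boolP ((m < N) || (N + n%:Z <= m)); first exact: fE.
have hi : (absz (m - N)%R < n)%N by lia.
by have := f0 (Ordinal hi); congr (f _ = 0); rewrite /=; lia.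
Qed.

(** * Multiplication of Laurent series in z by power series *)

Section MulSeries.
Context (K : fieldType) (W : lmodType K).
Implicit Types (f : int -> W) (g : nat -> K).

Lemma mul_seriesE g f j n : (forall i : nat, (n <= i)%N -> f (j - i%:Z) = 0) ->
  mul_series g f j = \sum_(i < n) g i *: f (j - i%:Z).
Proof.
move=> f0; rewrite /mul_series (fsbigTE [fset i in iota 0 n]%fset); last first.
  by move=> i; rewrite !inE mem_iota /= add0n -leqNgt => /f0 ->; rewrite scaler0.
rewrite -(big_mkord xpredT (fun i => g i *: f (j - i%:Z))) /index_iota subn0.
apply: perm_big; apply: uniq_perm; [exact: fset_uniq|exact: iota_uniq|].
by move=> m; rewrite !inE.
Qed.

Lemma mul_series_laurent g f : laurent f -> laurent (mul_series g f).
Proof.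
move=> [N fN]; exists N => j hj; rewrite (@mul_seriesE _ _ _ 0) ?big_ord0 //.
by move=> i _; apply: fN; lia.
Qed.

Lemma mul_seriesC g1 g2 f : laurent f ->
  mul_series g1 (mul_series g2 f) =1 mul_series g2 (mul_series g1 f).
Proof.
move=> [N fN] j; pose n := absz (j + 1 - N)%R.
have E (g g' : nat -> K) : mul_series g (mul_series g' f) j =
    \sum_(i < n) \sum_(i' < n) (g i * g' i') *: f (j - i%:Z - i'%:Z).
  have E' : laurent (mul_series g' f) by apply: mul_series_laurent; exists N.
  rewrite (@mul_seriesE _ _ _ n).
    apply: eq_bigr => i _; rewrite (@mul_seriesE _ _ _ n).
      by rewrite scaler_sumr; apply: eq_bigr => i' _; rewrite scalerA.
    by move=> i' hi'; apply: fN; lia.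
  move=> i hi; rewrite (@mul_seriesE _ _ _ 0) ?big_ord0 // => i' _.
  by apply: fN; lia.
rewrite !E exchange_big; apply: eq_bigr => i _; apply: eq_bigr => i' _.
by rewrite mulrC; congr (_ *: f _); lia.
Qed.

Lemma mul_series_inj g f1 f2 (i : nat) : g i != 0 -> laurent f1 -> laurent f2 ->
  mul_series g f1 =1 mul_series g f2 -> f1 =1 f2.
Proof.
move=> gi; case: (ex_minnP (P := fun i => g i != 0)); first by exists i.
move=> {gi}i gi imin [N1 f1N] [N2 f2N] fE.
pose N := Order.min N1 N2.
have {}imin k : (k < i)%N -> g k = 0.
  by move=> ki; apply/eqP; apply: contraTT ki => /imin; rewrite -leqNgt.
suff H n j : j < N + n%:Z -> f1 j = f2 j.
  by move=> j; apply: (H (absz (j + 1 - N)%R)); lia.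
elim: n j => [|n IHn] j hj; first by rewrite f1N ?f2N //; lia.
have [hj'|hj'] := ltP j (N + n%:Z); first exact: IHn.
have {hj hj'} -> : j = N + n%:Z by lia.
(* Here i is the order of g: terms of index below i vanish and those above i agree by induction,
   which leaves g i times the coefficient of z^(N + n). *)
have := fE (N + n%:Z + i%:Z).
rewrite !(@mul_seriesE _ _ _ (i + n).+1); first last.
- by move=> k hk; apply: f1N; lia.
- by move=> k hk; apply: f2N; lia.
have hi : (i < (i + n).+1)%N by lia.
rewrite (bigD1 (Ordinal hi)) //= [in RHS](bigD1 (Ordinal hi)) //= !addrK.
set s1 := \sum_(k < _ | _) _; set s2 := \sum_(k < _ | _) _.
suff -> : s1 = s2 by move/addIr/(scalerI gi).
apply: eq_bigr => k /eqP ki.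
have {}ki : (k : nat) <> i by move=> ki'; apply: ki; exact: val_inj.
have [/imin ->|hk] := ltnP k i; first by rewrite !scale0r.
by rewrite IHn //; lia.
Qed.

End MulSeries.

(** * The substitution x = e^z in Laurent polynomials *)

Section ExpSubst.
Context (K : numFieldType) (W : lmodType K).
Implicit Types (f : int -> W) (h : {poly K}).

(** In characteristic 0 the numbers 0, ..., size h - 1 are distinct, so the first [size h]
    coefficients of h(e^z) determine h through an invertible Vandermonde matrix. *)
Lemma exp_coef_neq0 h : h != 0 -> exists i, exp_coef h i != 0.
Proof.
move=> h0; apply: contrapT => H; case/negP: h0; apply/eqP.
have {}H i : exp_coef h i = 0 by apply/eqP/negPn/negP => hi; apply: H; exists i.
apply/polyP => l; rewrite coef0.
have [hl|hl] := leqP (size h) l; first by rewrite nth_default.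
pose n := size h; pose x (l : 'I_n) : K := l%:R.
have xinj : injective x.
  by move=> i j /eqP; rewrite eqr_nat => /eqP/val_inj.
pose v : 'cV[K]_n := \col_l h`_l.
have : Vandermonde n (\row_j x j) *m v = 0.
  apply/matrixP => i j; rewrite !mxE -[RHS](mul0r i`!%:R).
  rewrite -[in RHS](H i) /exp_coef mulr_suml; apply: eq_bigr => k _; rewrite !mxE mulrC /x.
  by rewrite -mulrA divfK // pnatr_eq0 -lt0n fact_gt0.
move/(congr1 (mulmx (invmx (Vandermonde n (\row_j x j))))).
rewrite mulKmx ?Vandermonde_unit // mulmx0 => /matrixP/(_ (Ordinal hl) 0).
by rewrite !mxE.
Qed.

(** This is [subst_exp] on a single line m + n = k, with f listing the coefficients along that
    line. *)
Definition exp_subst f (j : int) : W :=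
  if j is Posz n then pairing (fun m => m%:~R ^+ n / n`!%:R) f else 0.

Lemma exp_subst_laurent f : laurent (exp_subst f).
Proof. by exists 0; case. Qed.

Lemma exp_subst_conv h f : fin_series f ->
  exp_subst (conv h f) =1 mul_series (exp_coef h) (exp_subst f).
Proof.
move=> ffin [j|j]; last first.
  rewrite (@mul_seriesE _ _ _ _ _ 0) ?big_ord0 // => i _.
  by have : Negz j - Posz i < 0; [lia|case: (_ - _)].
rewrite (@mul_seriesE _ _ _ _ _ j.+1); last first.
  by move=> i hi; have : Posz j - Posz i < 0; [lia|case: (_ - _)].
rewrite /= pairing_conv //.
transitivity (\sum_(i < j.+1) \sum_(l < size h) (h`_l * (l%:R ^+ i / i`!%:R)) *:
    pairing (fun m => m%:~R ^+ (j - i) / (j - i)`!%:R) f); last first.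
  apply: eq_bigr => i _; rewrite -scaler_suml subzn //.
  by have := ltn_ord i; lia.
rewrite exchange_big; apply: eq_bigr => l _ /=.
under eq_bigr => i _ do rewrite -scalerA.
rewrite -scaler_sumr; congr (_ *: _).
have Hfin (i : nat) : fin_series (fun m : int =>
    (l%:R ^+ i / i`!%:R) *: ((m%:~R ^+ (j - i) / (j - i)`!%:R) *: f m)).
  by apply: (@fin_seriesZ _ _ (fun=> _)); exact: fin_seriesZ.
transitivity (\sum_(m \in [set: int]) \sum_(i < j.+1)
    (l%:R ^+ i / i`!%:R) *: ((m%:~R ^+ (j - i) / (j - i)`!%:R) *: f m)).
  apply: eq_fsbigr => m _; under eq_bigr => i _ do rewrite scalerA.
  rewrite -scaler_suml; congr (_ *: _).
  (* The binomial expansion of (m + l)^j / j! is the Cauchy product of the coefficients of e^(lz)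
     and e^(mz). *)
  rewrite rmorphD exprDn mulr_suml; apply: eq_bigr => i _ /=.
  have ij : (i <= j)%N by have := ltn_ord i; lia.
  have /(congr1 (GRing.natmul (1 : K))) := bin_fact ij.
  rewrite !natrM => E.
  have f0 k : k`!%:R != 0 :> K by rewrite pnatr_eq0 -lt0n fact_gt0.
  rewrite -mulr_natr -E; move: (f0 i) (f0 (j - i)%N) (f0 j) => i0 ji0 j0.
  have b0 : 'C(j, i)%:R != 0 :> K by rewrite pnatr_eq0 -lt0n bin_gt0.
  rewrite -pmulrn; field.
  by rewrite i0 ji0 b0.
rewrite (fsum_sum _ Hfin).1; apply: eq_bigr => i _.
by rewrite fsumZ //; exact: fin_seriesZ.
Qed.

End ExpSubst.

(** * Values of a product at a simple pole *)

Section Local.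
Context (K : numFieldType) (W : lmodType K).

Lemma exp_coefE n (h : {poly K}) i : (size h <= n)%N ->
  exp_coef h i = \sum_(l < n) h`_l * (l%:R ^+ i / i`!%:R).
Proof.
move=> hn; rewrite /exp_coef.
rewrite (big_ord_widen n (fun l => h`_l * (l%:R ^+ i / i`!%:R))) //.
rewrite big_mkcond; apply: eq_bigr => l _; case: ltnP => // hl.
by rewrite nth_default // mul0r.
Qed.

(** The sum is the coefficient of z in h(c e^z), the factor that meets the polar term in
    [ev_simple_pole]. *)
Lemma mul_horner_deriv (h : {poly K}) c :
  c * h^`().[c] = \sum_(i < size h) h`_i * c ^+ i * i%:R.
Proof.
rewrite (@horner_coef_wide _ (size h)) //; last first.
  by rewrite (leq_trans (size_poly _ _)) ?leq_pred.
pose G i := h`_i * c ^+ i * i%:R.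
transitivity (\sum_(i < (size h).+1) G i); last first.
  by rewrite big_ord_recr /= /G nth_default ?leqnn // !mul0r addr0.
rewrite big_ord_recl /G mulr0 add0r mulr_sumr; apply: eq_bigr => i _ /=.
by rewrite /bump add1n coef_deriv -mulr_natr exprS; ring.
Qed.

(* [Phi] is the expansion in [z], at [x = c e^z], of the rational function whose
   expansion at infinity is [f]; it may have a simple pole. *)
Lemma ev_simple_pole (c : K) (f Phi : int -> W) (h0 h : {poly K}) :
    let fc m := c ^ m *: f m in
    (forall j, j < -1 -> Phi j = 0) ->
    h0 != 0 -> fin_series (conv h0 fc) ->
    mul_series (exp_coef h0) Phi =1 exp_subst (conv h0 fc) ->
    c != 0 -> fin_series (conv h f) ->
  ev c (conv h f) = h.[c] *: Phi 0 + (c * h^`().[c]) *: Phi (-1).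
Proof.
move=> fc Phi0 h00 h0fin PhiE c0 hfin.
(* H(x) = h(c x), matching the rescaling of x by c in [fc]. *)
pose H := \poly_(i < size h) (h`_i * c ^+ i).
have Hc : conv H fc = fun m => c ^ m *: conv h f m.
  apply/funext => m; rewrite (@convE _ _ (size h)) ?size_poly // /conv scaler_sumr.
  apply: eq_bigr => i _; rewrite coef_poly ltn_ord !scalerA /fc.
  rewrite -[c ^+ i]/(c ^ i%:Z) -mulrA -expfzDr // mulrC; congr (_ ^ _ * _ *: _).
  by lia.
have Hfin : fin_series (conv H fc) by rewrite Hc; exact: fin_seriesZ.
have PhiL : laurent Phi by exists (-1).
have [i hi] := exp_coef_neq0 h00.
have E : exp_subst (conv H fc) =1 mul_series (exp_coef H) Phi.
  (* Both sides agree after multiplication by the nonzero power series h0(e^z), which can be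
     cancelled. *)
  apply: (mul_series_inj hi); [exact: exp_subst_laurent|exact: mul_series_laurent|].
  move=> j; rewrite -exp_subst_conv // -convM mulrC convM exp_subst_conv //.
  by rewrite -(funext PhiE) mul_seriesC.
(* As [Phi] starts at z^-1, only the coefficients of 1 and z in H(e^z) = h(c e^z) reach the constant
   term. *)
have := E 0; rewrite (@mul_seriesE _ _ _ _ _ 2); last first.
  by move=> k hk; apply: Phi0; lia.
rewrite !big_ord_recl big_ord0 !addr0.
rewrite (_ : lift ord0 ord0 = 1%N :> nat) // => EE.
have -> : ev c (conv h f) = exp_subst (conv H fc) 0.
  apply: eq_fsbigr => m _; rewrite Hc expr0 divr1 scale1r //.
rewrite EE; congr (_ *: _ + _ *: _).
  rewrite (@exp_coefE (size h)) ?size_poly // horner_coef.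
  by apply: eq_bigr => l _; rewrite coef_poly ltn_ord expr0 divr1 mulr1.
rewrite (@exp_coefE (size h)) ?size_poly // mul_horner_deriv.
by apply: eq_bigr => l _; rewrite coef_poly ltn_ord expr1 divr1.
Qed.

End Local.

(** * Reversal of exponents and the factor (x + 1)/(x - 1) *)

Lemma conv_rev (K : fieldType) (W : lmodType K) (p : K) (f : int -> W) a : p != 0 ->
  let q := ('X - p%:P) * ('X - p^-1%:P) in
  conv q (fun m => f (a - m)) = fun m => conv q f (a + 2 - m).
Proof.
(* q is palindromic, x^2 q(1/x) = q(x), whence the shift by 2. *)
move=> p0 q; apply/funext => m; rewrite /q !convM !conv_XsubC !scalerBr !scalerA.
rewrite mulfV //.
rewrite (_ : a - (m - 1 - 1) = a + 2 - m); last by lia.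
rewrite (_ : a - (m - 1) = a + 2 - m - 1); last by lia.
rewrite (_ : a + 2 - m - 1 - 1 = a - m); last by lia.
rewrite !scale1r !opprB addrACA [RHS]addrACA; congr (_ + _); exact: addrC.
Qed.

Lemma ev_rev (K : fieldType) (W : lmodType K) (c : K) (f : int -> W) a :
  c != 0 -> fin_series f -> ev c (fun m => f (a - m)) = c ^ a *: ev c^-1 f.
Proof.
move=> c0 hf; rewrite /ev /pairing -fsumZ; last exact: fin_seriesZ.
rewrite -[RHS](fsum_rev _ a); apply: eq_fsbigr => m _.
by rewrite scalerA exprz_inv opprB -expfzDr // addrCA subrr addr0.
Qed.

Definition cayley_coef {K : fieldType} (l : nat) : K := if l == 0 then 1 else 2.

(* (1 + 1/x)/(1 - 1/x) f(x), expanded at infinity. *)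
Definition cayley {K : fieldType} {W : lmodType K} (f : int -> W) (m : int) : W :=
  mul_series cayley_coef (fun i => f (- i)) (- m).

Lemma cayley_bounded_above (K : fieldType) (W : lmodType K) (f : int -> W) :
  bounded_above f -> bounded_above (cayley f).
Proof.
move=> [N fN]; exists N => m hm.
rewrite /cayley (@mul_seriesE _ _ _ _ _ 0) ?big_ord0 // => i _; apply: fN; lia.
Qed.

Lemma cayleyE (K : fieldType) (W : lmodType K) (f : int -> W) m n :
    (forall i : nat, (n < i)%N -> f (m + i%:Z) = 0) ->
  cayley f m = f m + \sum_(i < n) 2 *: f (m + i.+1%:Z).
Proof.
move=> f0; rewrite /cayley (@mul_seriesE _ _ _ _ _ n.+1); last first.
  by move=> i hi; rewrite -(f0 i) //; congr f; lia.
rewrite big_ord_recl scale1r subr0 opprK; congr (_ + _); apply: eq_bigr => i _.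
by congr (_ *: f _); rewrite lift0; lia.
Qed.

(** The tails with coefficient 2 cancel up to one term. In terms of series, multiplying [cayley f]
    by x - 1 gives (x + 1) f. *)
Lemma cayley_telescope (K : fieldType) (W : lmodType K) (f : int -> W) m :
  bounded_above f -> cayley f (m - 1) - cayley f m = f m + f (m - 1).
Proof.
move=> [N fN]; pose n := absz (N - m)%R.
rewrite (@cayleyE _ _ f m n); last by move=> i hi; apply: fN; lia.
rewrite (@cayleyE _ _ f (m - 1) n.+1); last by move=> i hi; apply: fN; lia.
rewrite big_ord_recl subrK.
rewrite (eq_bigr (fun i : 'I_n => 2 *: f (m + i.+1%:Z))); last first.
  by move=> i _; congr (_ *: f _); rewrite lift0; lia.
by rewrite addrA opprD addrACA addrN addr0 scaler_nat mulr2n addrA addrK addrC.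
Qed.

Lemma expz_inj (K : fieldType) (p : K) : p != 0 ->
  (forall n : nat, (0 < n)%N -> p ^+ n != 1) -> injective (fun n : int => p ^ n).
Proof.
move=> p0 pn; suff H (m n : int) : m <= n -> p ^ m = p ^ n -> m = n.
  by move=> m n E; have [/H|/ltW/H] := leP m n; [exact|move=> /(_ (esym E))].
move=> mn E; have : p ^ (n - m) = 1.
  by by rewrite expfzDr // -invr_expz -E mulfV // expfz_neq0.
rewrite -[n - m]gez0_abs ?subr_ge0 // -exprnP => E1.
have [|h] := posnP (absz (n - m)%R); first by lia.
by move/eqP: E1; rewrite (negPf (pn _ h)).
Qed.

(** * A rational function with simple poles at p and 1/p, and its two expansions *)

Section Residues.
Context (K : numClosedFieldType) (W : lmodType K) (p : K) (k : int).
(* [a r] and [b r] are the coefficients of z^0 and z^-1 in the expansion, at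
   x = p^r e^z, of the rational function whose expansion at infinity is [f]. *)
Context (f : int -> W) (a b : int -> W) (v : W).
Hypothesis p0 : p != 0.
Hypothesis pn : forall n : nat, (0 < n)%N -> p ^+ n != 1.
Hypothesis f_bounded : bounded_above f.
Hypothesis ev_conv_f : forall r h, fin_series (conv h f) ->
  ev (p ^ r) (conv h f) = h.[p ^ r] *: a r + (p ^ r * h^`().[p ^ r]) *: b r.
Hypothesis b1 : b 1 = 2 *: v.
Hypothesis bN1 : b (-1) = 2 *: v.
Hypothesis b0 : forall r, r <> 1 -> r <> -1 -> b r = 0.
Hypothesis aN : forall r, a r = - (p ^ (r * k) *: a (- r)).

Let q := ('X - p%:P) * ('X - p^-1%:P).

Lemma q_horner c : q.[c] = (c - p) * (c - p^-1).
Proof. by rewrite hornerM !hornerXsubC. Qed.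

Lemma deriv_q_horner c : q^`().[c] = 2 * c - p - p^-1.
Proof.
rewrite derivM !derivXsubC mul1r mulr1 hornerD !hornerXsubC; ring.
Qed.

(* At each root p^r of [h], the factor [q * h] cancels the pole of [f] with one
   power of x - p^r to spare, so this root can be removed from [h]. *)
Lemma conv_q_fin h : h != 0 -> (forall z, root h z -> exists r : int, z = p ^ r) ->
  fin_series (conv (q * h) f) -> fin_series (conv q f).
Proof.
move: {2}(size h) (leqnn (size h)) => n; elim: n h => [|n IHn] h hn h0 hroot hfin.
  by move: hn; rewrite leqn0 size_poly_eq0 (negPf h0).
have [/size_poly1P [c c0 hc]|/closed_rootP [z hz]] := boolP (size h == 1).
  move: hfin; rewrite hc mulrC mul_polyC convZ => /(fin_seriesZ (fun=> c^-1)).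
  by under eq_fun do rewrite scalerA mulVf // scale1r.
have [r zr] := hroot z hz.
have [h' hE] := factor_theorem h z hz.
have h'0 : h' != 0 by apply: contraNneq h0 => h'0; rewrite hE h'0 mul0r.
apply: (IHn h') => //.
- by move: hn; rewrite hE size_Mmonic ?monicXsubC // size_XsubC addn2.
- by move=> y hy; apply: hroot; rewrite hE rootM hy.
have z0 : z != 0 by rewrite zr expfz_neq0.
have E : q * h = ('X - z%:P) * (q * h') by rewrite hE; ring.
apply: (divide_root z0 f_bounded); rewrite -E //.
rewrite zr ev_conv_f // -zr hornerM (rootP hz) mulr0 scale0r add0r.
rewrite derivM hornerD (hornerM q^`()) (hornerM q) (rootP hz) mulr0 add0r q_horner.
have [r1|r1] := eqVneq r 1; first by rewrite zr r1 expr1z subrr !(mul0r, mulr0) scale0r.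
have [rN1|rN1] := eqVneq r (-1).
  by rewrite zr rN1 exprN1 subrr !(mul0r, mulr0) scale0r.
by rewrite b0 ?scaler0 //; exact/eqP.
Qed.

Hypothesis qf_fin : fin_series (conv q f).

Let P := conv q f.

(** By [aN] and x^2 q(1/x) = q(x), the Laurent polynomial P(x) + x^(k+2) P(1/x) vanishes at
    infinitely many powers of p. *)
Lemma residue_antisym m : P (k + 2 - m) = - P m.
Proof.
pose Q m := P m + P (k + 2 - m).
suff Q0 : forall m, Q m = 0 by apply/eqP; rewrite -addr_eq0 addrC; exact/eqP/Q0.
(* From r = 2 on, p^r and p^-r avoid both poles, so only the regular parts [a] enter. *)
apply: (@ev_inj0 _ _ (fun j => p ^ j.+2%:Z)).
- by move=> i j /(expz_inj p0 pn); lia.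
- by move=> j; rewrite expfz_neq0.
- by apply: fin_seriesD => //; exact: fin_series_rev.
move=> j; set r := j.+2%:Z; have c0 : p ^ r != 0 by rewrite expfz_neq0.
rewrite /ev /Q pairingD //; last exact: fin_series_rev.
rewrite -!/(ev _ _) ev_rev // invr_expz !ev_conv_f //.
rewrite [b r]b0 ?[b (- r)]b0; [|by rewrite /r; lia..].
rewrite !scaler0 !addr0 aN -scaleNr !scalerA -scalerDl.
rewrite !q_horner expfzDr // -exprz_exp -invr_expz.
move: (p ^ r) c0 => c c0.
rewrite (_ : _ + _ = 0) ?scale0r //.
rewrite -exprnP; field.
by rewrite c0 p0.
Qed.

Lemma regular_part0 : a 0 = 0.
Proof.
have /eqP := aN 0; rewrite mul0r expr0z oppr0 scale1r -addr_eq0 -mulr2n.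
by rewrite -scaler_nat scaler_eq0 pnatr_eq0 => /eqP.
Qed.

Lemma ev_P1 : ev 1 P = 0.
Proof.
have := @ev_conv_f 0 q qf_fin; rewrite expr0z => ->.
by rewrite regular_part0 b0 ?scaler0 ?addr0.
Qed.

Lemma ev_Pp : ev p P = (p * (p - p^-1)) *: (2 *: v).
Proof.
have := @ev_conv_f 1 q qf_fin; rewrite expr1z => ->.
rewrite b1 q_horner subrr mul0r scale0r add0r deriv_q_horner.
by congr (_ *: _); ring.
Qed.

Lemma ev_PpV : ev p^-1 P = (p^-1 * (p^-1 - p)) *: (2 *: v).
Proof.
have := @ev_conv_f (-1) q qf_fin; rewrite exprN1 => ->.
rewrite bN1 q_horner subrr mulr0 scale0r add0r deriv_q_horner.
by congr (_ *: _); ring.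
Qed.

Lemma cayley_commutator m :
  cayley f m - cayley f (k - m) =
  (-2 * ((1 + p) / (1 - p)) * (p ^ (- m) - p ^ m)) *: v.
Proof.
(* These are the expansions at infinity and at 0 of one rational function: [FE] and [GE] show that
   both become (x + 1) P after multiplication by q(x)(x - 1). *)
pose F := cayley f; pose G m := F (k - m).
have Fb : bounded_above F by exact: cayley_bounded_above.
have Gl : laurent G.
  by case: Fb => N FN; exists (k - N) => i hi; apply: FN; lia.
have S i : conv ('X + 1%:P) P i = P (i - 1) + P i.
  by rewrite -[X in 'X + X]opprK -polyCN conv_XsubC scaleN1r opprK.
have FE : conv q (conv ('X - 1%:P) F) = conv ('X + 1%:P) P.
  rewrite (_ : conv ('X - 1%:P) F = conv ('X + 1%:P) f).
    by rewrite /P -!convM mulrC.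
  apply/funext => i; rewrite conv_XsubC scale1r cayley_telescope //.
  by rewrite -[X in 'X + X]opprK -polyCN conv_XsubC scaleN1r opprK addrC.
have GE : conv q (conv ('X - 1%:P) G) = conv ('X + 1%:P) P.
  rewrite (_ : conv ('X - 1%:P) G =
      fun i => -1 *: (f (k - i) + f (k + 1 - i))); last first.
    apply/funext => i; rewrite conv_XsubC scale1r scaleN1r /G /F.
    rewrite (_ : k - (i - 1) = k + 1 - i); last by lia.
    rewrite -opprB (_ : k - i = k + 1 - i - 1); last by lia.
    by rewrite cayley_telescope // addrC.
  rewrite convZr convDr !conv_rev //; apply/funext => i.
  rewrite S scaleN1r opprD addrC -!residue_antisym /P.
  by congr (conv q f _ + conv q f _); lia.
have conv1 h i : conv ('X - 1%:P) h i = h (i - 1) - 1 *: h i := conv_XsubC 1 h i.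
(* P(1) = 0 leaves no residue at 1, so x - 1 can be cancelled. The common product is then bounded
   above through [F] and below through [G]. *)
have BE : conv q F = conv q G.
  apply/funext => i; apply/eqP; rewrite -subr_eq0.
  have := @residue _ _ 1 (conv q F) (conv q G) (conv ('X + 1%:P) P) i
    (oner_neq0 _) (conv_bounded_above _ Fb) (conv_laurent _ Gl).
  rewrite ev_conv // ?oner_neq0 // ev_P1 scaler0 exp1rz scale1r => -> //.
    by move=> j _; rewrite -conv1 -FE -!convM mulrC.
  by move=> j _; rewrite -conv1 -GE -!convM mulrC.
pose B := conv q F.
have Bfin : fin_series B.
  by split; [rewrite /B BE; exact: conv_laurent|exact: conv_bounded_above].
have evB c : c != 0 -> (c - 1) *: ev c B = (c + 1) *: ev c P.
  move=> c0; have BS : conv ('X - 1%:P) B = conv ('X + 1%:P) P.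
    by rewrite -FE /B -!convM mulrC.
  rewrite -[c - 1]hornerXsubC -ev_conv // BS ev_conv //.
  by rewrite hornerD hornerX hornerC.
(* Cancelling x - c makes (x - c')(F - G) a delta series weighted by B(c). The cases c = p and c =
   1/p give two equations, whose difference eliminates the coefficients at m - 1. *)
have D c : c != 0 -> forall c', q = ('X - c%:P) * ('X - c'%:P) ->
    c ^ (m + 1) *: (F (m - 1) - G (m - 1) - c' *: (F m - G m)) = ev c B.
  move=> c0 c' qE.
  have -> : F (m - 1) - G (m - 1) - c' *: (F m - G m) =
      conv ('X - c'%:P) F m - conv ('X - c'%:P) G m.
    rewrite !conv_XsubC scalerBr !opprB addrACA [RHS]addrACA.
    by congr (_ + _); exact: addrC.
  apply: residue => //; [exact: conv_bounded_above|exact: conv_laurent|..].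
    by move=> j _; rewrite -conv_XsubC -convM -qE.
  by move=> j _; rewrite -conv_XsubC -convM -qE /B BE.
have pV0 : p^-1 != 0 by rewrite invr_eq0.
have := D _ p0 p^-1 erefl; have := D _ pV0 p (mulrC _ _).
have := evB _ p0; have := evB _ pV0; rewrite ev_Pp ev_PpV.
have p1 : p - 1 != 0 by rewrite subr_eq0 (pn (n := 1)).
have pV1 : p^-1 - 1 != 0 by rewrite subr_eq0 invr_eq1 (pn (n := 1)).
have p2 : p - p^-1 != 0.
  apply/negP => /eqP/(congr1 ( *%R p)); rewrite mulrBr mulfV // mulr0 => /eqP.
  by rewrite subr_eq0 -expr2 (negPf (pn _)).
move=> /(congr1 ( *:%R (p^-1 - 1)^-1)); rewrite [in LHS]scalerA mulVf // scale1r => ->.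
move=> /(congr1 ( *:%R (p - 1)^-1)); rewrite [in LHS]scalerA mulVf // scale1r => ->.
have pm : p ^ (m + 1) != 0 by rewrite expfz_neq0.
move=> /(congr1 ( *:%R (p ^ (m + 1)))).
rewrite [in LHS]scalerA exprz_inv -expfzDr // subrr expr0z scale1r => E2.
move=> /(congr1 ( *:%R (p ^ (m + 1))^-1)).
rewrite [in LHS]scalerA mulVf // scale1r => E1.
have : (p - p^-1) *: (F m - G m) =
    (F (m - 1) - G (m - 1) - p^-1 *: (F m - G m))
    - (F (m - 1) - G (m - 1) - p *: (F m - G m)).
  by rewrite scalerBl opprB [RHS]addrC subrKA.
rewrite E1 E2 !scalerA -scalerBl.
move=> /(congr1 ( *:%R (p - p^-1)^-1)); rewrite [in LHS]scalerA mulVf // scale1r.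
rewrite /G => ->; rewrite scalerA; congr (_ *: _).
rewrite -invr_expz expfzDr // expr1z.
have pm0 : p ^ m != 0 by rewrite expfz_neq0.
move: (p ^ m) pm0 => y y0; field.
by rewrite -[1 - p]opprB oppr_eq0 y0 p0 p1 subr_eq0 -expr2 pn.
Qed.

End Residues.

(** * Products Y(a, z)b of generators of the Clifford vertex superalgebra *)

Section Clifford.
Context (K : fieldType).

Lemma clmodeD (a b : Espace K) m n :
  clmode a m * clmode b n + clmode b n * clmode a m =
  (eform a b * (m + n + 1 == 0)%:R) *: (1 : clifford K).
Proof.
rewrite /clmode.
rewrite -[X in X + _](presented_piM (@clifford_rel K)).
rewrite -[X in _ + X](presented_piM (@clifford_rel K)).
rewrite -presented_piD -[RHS](presented_piZ (@clifford_rel K) _ 1).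
by apply: presented_pi_eq; apply: IdealRel; exact: CliffordRel.
Qed.

Lemma VE_pi0 : VE_pi (0 : clifford K) = 0.
Proof.
by have := lmod_piD (@annihilation_product K) 0 0;
  rewrite addr0 => /esym/eqP; rewrite -subr_eq0 addrK => /eqP.
Qed.

Lemma VE_pi_annihilation (c : clifford K) a (n : nat) : VE_pi (c * clmode a n) = 0.
Proof.
rewrite -VE_pi0; apply: lmod_pi_eq; rewrite subr0 -[_ * _]scale1r.
exact/SpanZ/AnnihilationProduct.
Qed.

Lemma VE_pi_anticomm (a b : Espace K) m n :
  VE_pi (clmode a m * clmode b n) + VE_pi (clmode b n * clmode a m) =
  (eform a b * (m + n + 1 == 0)%:R) *: VE_vac K.
Proof. by rewrite -[LHS]lmod_piD clmodeD [LHS]lmod_piZ. Qed.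

Context (par : bool -> VE K -> Prop) (Y : VE K -> VE K -> int -> VE K).
Hypothesis HY : VE_structure par Y.

Lemma Y_VE_of (a b : Espace K) i :
  Y (VE_of a) (VE_of b) i = VE_pi (clmode a (- i - 1) * clmode b (-1)).
Proof. by rewrite -(VE_Y HY) /vmode; congr Y; lia. Qed.

(** For i < 0 the mode a_(-i-1) kills the vacuum, so moving it past b_(-1) leaves the
    anticommutator, which can be nonzero only for a_0. *)
Lemma Y_VE_of_neg (a b : Espace K) i : i < 0 ->
  Y (VE_of a) (VE_of b) i = (eform a b * (i == -1)%:R) *: VE_vac K.
Proof.
move=> i0; have [n ->] : exists n : nat, i = - n%:Z - 1.
  by exists (absz (i + 1)%R); lia.
rewrite Y_VE_of (_ : - (- n%:Z - 1) - 1 = n%:Z); last by lia.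
have := VE_pi_anticomm a b n (-1).
rewrite [X in _ + X](VE_pi_annihilation (clmode b (-1)) a n) addr0 => ->.
congr ((_ * (nat_of_bool _)%:R) *: _); lia.
Qed.

(** Both coefficients come from modes of index -1, which anticommute since (-1) + (-1) + 1 is not
    0. *)
Lemma Y_VE_of_skew (a b : Espace K) :
  Y (VE_of a) (VE_of b) 0 = - Y (VE_of b) (VE_of a) 0.
Proof.
apply/eqP; rewrite -addr_eq0 !Y_VE_of VE_pi_anticomm.
by rewrite mulr0 scale0r.
Qed.

Lemma eform_basis r s :
  eform (ebasis K r) (ebasis K s) = 2 * ((r == s + 1)%:R + (r == s - 1)%:R).
Proof.
by rewrite /eform /ebasis !msuppU oner_eq0 !big_seq_fset1 !mcoeffUU !mul1r.
Qed.

End Clifford.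

(** * From the module axioms to the relation on each line m + n = k *)

Lemma laurent2_line (K : fieldType) (W : lmodType K) (F : int -> int -> W) k :
  laurent2 F -> fin_series (fun m => F m (k - m)).
Proof.
move=> [N FN]; split; [exists N|exists (k - N)] => m hm; apply: FN; lia.
Qed.

Lemma poly_ratio_mul_line (K : fieldType) (W : lmodType K) h (A B : W -> int -> W) w k :
  (fun m => poly_ratio_mul h A B w m (k - m)) = conv h (fun m => A (B w (k - m)) m).
Proof.
apply/funext => m; apply: eq_bigr => i _; congr (_ *: A (B w _) _); lia.
Qed.

Section Main.
Context (K : numClosedFieldType) (p : K) (par : bool -> VE K -> Prop).
Context (Y : VE K -> VE K -> int -> VE K) (sigma : int -> VE K -> VE K).
Context (W : lmodType K) (YW : VE K -> W -> int -> W).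
Hypothesis p0 : p != 0.
Hypothesis pn : forall n : nat, (0 < n)%N -> p ^+ n != 1.
Hypothesis HY : VE_structure par Y.
Hypothesis Hsigma : VE_action par Y sigma.
Hypothesis HW : covariant_phi_coordinated_quasi_module (VE_vac K) Y YW
  sigma (fun n : int => p ^ n).

Let e (r : int) : VE K := VE_of (ebasis K r).
Let HM := cov_module HW.

Lemma YWZ c u w n : YW (c *: u) w n = c *: YW u w n.
Proof. exact: (GRing.scalable_linear (pcq_linear HM w n)). Qed.

Lemma YWN u w n : YW (- u) w n = - YW u w n.
Proof. by rewrite -[- u]scaleN1r YWZ scaleN1r. Qed.

Lemma YW0r u n : YW u 0 n = 0.
Proof.
have /GRing.scalable_linear L := (pcq_field HM u).1 n.
by have := L 0 0; rewrite /= !scale0r.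
Qed.

Lemma e_shift r s : e (r + s) = sigma r (e s).
Proof. by rewrite /e (VE_act_basis Hsigma). Qed.

Lemma YW_e r w n : YW (e (1 + r)) w n = (p ^ r) ^ n *: YW (e 1) w n.
Proof. by rewrite addrC e_shift (cov_equivariant HW). Qed.

Lemma cayley_ratio_mulE w m n (A := YW (e 1)) :
  cayley_ratio_mul A A w m n = cayley (fun i => A (A w (m + n - i)) i) m.
Proof.
apply: eq_fsbigr => l _; congr (_ *: A (A w _) _); lia.
Qed.

Lemma cayley_commutator_YW w m n (A := YW (e 1)) :
  cayley_ratio_mul A A w m n - cayley_ratio_mul A A w n m =
  (- 2 * ((1 + p) / (1 - p)) * (delta_ratio p m n - delta_ratio p^-1 m n)) *: w.
Proof.
rewrite !cayley_ratio_mulE [n + m]addrC; set k := m + n.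
pose f i := A (A w (k - i)) i; rewrite -/f.
have fb : bounded_above f.
  have [N AN] := (pcq_field HM (e 1)).2 w.
  by exists (k - N) => i hi; rewrite /f /A AN ?YW0r //; lia.
pose Phi r i := YW (Y (e (1 + r)) (e 1) i) w k.
(* The vacuum acts as the constant series 1, so the polar term is seen at x2^k only for k = 0. *)
pose v : W := if k == 0 then w else 0.
have Phi_neg r i : i < 0 -> Phi r i =
    (eform (ebasis K (1 + r)) (ebasis K 1) * (i == -1)%:R) *: v.
  by move=> i0; rewrite /Phi (Y_VE_of_neg HY) // YWZ (pcq_vacuum HM).
have evf r h : fin_series (conv h f) ->
    ev (p ^ r) (conv h f) = h.[p ^ r] *: Phi r 0 + (p ^ r * h^`().[p ^ r]) *: Phi r (-1).
  (* By covariance, rescaling x1 by p^r turns the field of e^(1) into that of e^(1+r), so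
     associativity for e^(1+r), e^(1) describes f near p^r. *)
  have fcE : (fun i => (p ^ r) ^ i *: f i) = fun i => YW (e (1 + r)) (A w (k - i)) i.
    by apply/funext => i; rewrite YW_e.
  have [h0 [h00 h0l h0E]] := pcq_assoc HM (e (1 + r)) (e 1).
  apply: (@ev_simple_pole _ _ _ _ (Phi r) h0); rewrite ?expfz_neq0 ?fcE //.
  - move=> j j1; rewrite Phi_neg; last exact: lt_trans j1 _.
    by rewrite (lt_eqF j1) mulr0 scale0r.
  - by rewrite -poly_ratio_mul_line; exact: laurent2_line.
  - by move=> j; rewrite [LHS]h0E -poly_ratio_mul_line; case: j.
(* Covariance, unlike associativity, supplies a denominator whose zeros are powers of p, as
   [conv_q_fin] requires. *)
have [h [h0 hroot hl]] := cov_locality HW (e 1) (e 1).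
have hfin : fin_series (conv h f).
  by rewrite -poly_ratio_mul_line; exact: laurent2_line.
have b1 : Phi 1 (-1) = 2 *: v.
  by rewrite Phi_neg // eform_basis /= addr0 !mulr1.
have bN1 : Phi (-1) (-1) = 2 *: v.
  by rewrite Phi_neg // eform_basis /= add0r !mulr1.
have b0 r : r <> 1 -> r <> -1 -> Phi r (-1) = 0.
  move=> r1 rN1; rewrite Phi_neg // eform_basis.
  have -> : (1 + r == 1 + 1) = false by lia.
  have -> : (1 + r == 1 - 1) = false by lia.
  by rewrite addr0 mulr0 mul0r scale0r.
(* The automorphism [sigma r] carries Y(e^(1-r), z)e^(1) to Y(e^(1), z)e^(1+r). Covariance gives the
   factor p^(rk), and [Y_VE_of_skew] the sign. *)
have aN r : Phi r 0 = - (p ^ (r * k) *: Phi (- r) 0).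
  rewrite -exprz_exp /Phi -(cov_equivariant HW) (vsa_aut_Y (VE_act_aut Hsigma _)).
  rewrite -!e_shift addrCA subrr addr0 [r + 1]addrC -YWN.
  by rewrite -(Y_VE_of_skew HY).
have qfin := conv_q_fin p0 fb evf b0 h0 hroot _.
rewrite {1}(_ : n = k - m); last by rewrite /k; lia.
rewrite (@cayley_commutator _ _ p k f (Phi^~ 0) (Phi^~ (-1)) v) //; last first.
  by apply: qfin; rewrite convM; exact: conv_fin_series.
rewrite /v /delta_ratio -/k; case: eqP => [k0|_]; last by rewrite subr0 mulr0 scale0r scaler0.
have -> : n = - m by rewrite /k in k0; lia.
by rewrite exprz_inv opprK.
Qed.

End Main.

Theorem theorem5p8 (R : realType) (p : R[i]) (p_neq0 : p != 0)
    (p_not_root_of_unity : forall n : nat, (0 < n)%N -> p ^+ n != 1)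
    (par : bool -> VE R[i] -> Prop) (Y : VE R[i] -> VE R[i] -> int -> VE R[i])
    (HY : VE_structure par Y)
    (sigma : int -> VE R[i] -> VE R[i]) (Hsigma : VE_action par Y sigma)
    (W : lmodType R[i]) (YW : VE R[i] -> W -> int -> W)
    (HW : covariant_phi_coordinated_quasi_module (VE_vac R[i]) Y YW
            sigma (fun n : int => p ^ n)) :
  restricted_Vir_module p
    (fun (n : int) (w : W) => YW (VE_of (ebasis R[i] 1)) w (- n)).
Proof.
have [lin res] := pcq_field (cov_module HW) (VE_of (ebasis _ 1)).
split=> [n|w|w m n].
- exact: lin.
- have [N HN] := res w; exists (- N) => n hn; apply: HN; lia.
- rewrite (_ : (fun w n => _) = YW (VE_of (ebasis _ 1))); last first.
    by apply/funext => x; apply/funext => j; rewrite opprK.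
  exact: (cayley_commutator_YW p_neq0 p_not_root_of_unity HY Hsigma HW).
Qed.
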